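(* The groups $\Pi_4(\mathbf{k})$ have the $R_\infty$ property.
   Context: Let $A=[\ell_{ij}]\in\mathrm{SL}(2,\mathbb{Z})$ have trace $>2$. For $\mathbf{x}=(x,y)^t\in\mathbb{Z}^2$ write $\mathbf{a}^{\mathbf{x}}=a_1^xa_2^y$; for an integer matrix $B=[b_{ij}]$ write $B(a_i)=a_1^{b_{1i}}a_2^{b_{2i}}$. Assume $A$ has the integer square root $$N=-\frac{1}{\sqrt{\ell_{11}+\ell_{22}-2}}\begin{bmatrix}\ell_{11}-1&\ell_{12}\\ \ell_{21}&\ell_{22}-1\end{bmatrix},$$ and let $\mathbf{k}\in\mathbb{Z}^2$ represent a class in $\mathbb{Z}^2/(2\mathbb{Z}^2+\mathrm{im}(I-N))$. Then $$\Pi_4(\mathbf{k})=\langle a_1,a_2,\alpha,\beta\mid [a_1,a_2]=1,\ \alpha a_i\alpha^{-1}=a_i^{-1},\ \alpha^2=1,\ \beta a_i\beta^{-1}=N(a_i),\ \alpha\beta\alpha^{-1}=\mathbf{a}^{\mathbf{k}}\beta\rangle.$$ The Reidemeister number $R(\varphi)$ of an endomorphism $\varphi$ of a group $G$ is the number (possibly $\infty$) of equivalence classes of the relation $\alpha\sim\gamma\alpha\varphi(\gamma)^{-1}$ ($\gamma\in G$) on $G$. $G$ has the $R_\infty$ property if $R(\varphi)=\infty$ for every automorphism $\varphi$ of $G$. *)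

(* Defs.v *)
From HB Require Import structures.
From mathcomp Require Import all_boot all_order all_algebra.
From mathcomp Require Import algC finmap.
From mathcomp Require Import boolp classical_sets cardinality.
From mathcomp Require Import constructive_ereal.

Set Implicit Arguments.
Unset Strict Implicit.
Unset Printing Implicit Defensive.

Import GRing.Theory Num.Theory.

Section Words.
Variable X : choiceType.

(* The letter (x, true) stands for x and the letter (x, false) for x^-1; words
   are not required to be reduced. *)
Definition word : Type := seq (X * bool).

Definition gen (x : X) : word := [:: (x, true)].

Definition winv (w : word) : word := rev [seq (l.1, ~~ l.2) | l <- w].

Definition wexp (w : word) (n : int) : word :=
  match n with
  | Posz m => flatten (nseq m w)
  | Negz m => flatten (nseq m.+1 (winv w))
  end.

Lemma winvK : involutive winv.
Proof.
move=> w; rewrite /winv map_rev revK -map_comp -[RHS]map_id.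
by apply: eq_map => -[x b] /=; rewrite negbK.
Qed.

Lemma winv_cat (u v : word) : winv (u ++ v) = winv v ++ winv u.
Proof. by rewrite /winv map_cat rev_cat. Qed.

End Words.

Section Presentations.
Variables (X : choiceType) (rel : word X -> word X -> Prop).

(* [rel u v] means that u = v is one of the defining relations. [pres_eq] is
   the smallest congruence on words containing them and the cancellations
   x x^-1 = x^-1 x = 1, i.e. equality in the group < X | rel >. *)
Inductive pres_eq : word X -> word X -> Prop :=
| pres_eq_rel u v : rel u v -> pres_eq u v
| pres_eq_cancel x b : pres_eq [:: (x, b); (x, ~~ b)] [::]
| pres_eq_refl u : pres_eq u u
| pres_eq_sym u v : pres_eq u v -> pres_eq v u
| pres_eq_trans u v w : pres_eq u v -> pres_eq v w -> pres_eq u w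
| pres_eq_cat u u' v v' :
    pres_eq u u' -> pres_eq v v' -> pres_eq (u ++ v) (u' ++ v').

Lemma pres_eq_catV w : pres_eq (w ++ winv w) [::].
Proof.
elim: w => [|[x b] w IHw]; first exact: pres_eq_refl.
rewrite -cat1s winv_cat -catA (catA w).
apply: pres_eq_trans (pres_eq_cancel x b).
apply: (pres_eq_cat (pres_eq_refl [:: (x, b)])).
exact: (pres_eq_cat IHw (pres_eq_refl [:: (x, ~~ b)])).
Qed.

Lemma pres_eq_Vcat w : pres_eq (winv w ++ w) [::].
Proof. by rewrite -{2}[w]winvK; apply: pres_eq_catV. Qed.

Lemma pres_eq_inv u v : pres_eq u v -> pres_eq (winv u) (winv v).
Proof.
move=> uv; apply: (@pres_eq_trans _ (winv u ++ (v ++ winv v))).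
  rewrite -{1}[winv u]cats0; apply: pres_eq_cat; first exact: pres_eq_refl.
  exact/pres_eq_sym/pres_eq_catV.
rewrite catA -[X in pres_eq _ X]cat0s.
apply: pres_eq_cat; last exact: pres_eq_refl.
apply: pres_eq_trans (pres_eq_Vcat u).
by apply: pres_eq_cat; [apply: pres_eq_refl|apply: pres_eq_sym].
Qed.

Definition pres_eqb (u v : seq (X * bool)) : bool := `[< pres_eq u v >].

Fact pres_eqb_refl : reflexive pres_eqb.
Proof. by move=> u; apply/asboolP/pres_eq_refl. Qed.

Fact pres_eqb_sym : symmetric pres_eqb.
Proof. by move=> u v; apply/asboolP/asboolP => /pres_eq_sym. Qed.

Fact pres_eqb_trans : transitive pres_eqb.
Proof.
by move=> v u w /asboolP uv /asboolP vw; apply/asboolP/(pres_eq_trans uv).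
Qed.

Definition pres_equiv :=
  EquivRel pres_eqb pres_eqb_refl pres_eqb_sym pres_eqb_trans.

Definition presented : Type := {eq_quot pres_equiv}%qT.
HB.instance Definition _ := Choice.on presented.

Definition wclass (w : word X) : presented := (\pi_({eq_quot pres_equiv}) w)%qT.

Definition wrepr (g : presented) : word X :=
  repr (g : {eq_quot pres_equiv}%qT).

Lemma wclassP u v : wclass u = wclass v <-> pres_eq u v.
Proof.
by rewrite /wclass; split=> [/eqmodP/asboolP|uv] //; apply/eqmodP/asboolP.
Qed.

Fact wreprK g : wclass (wrepr g) = g.
Proof. exact: reprK. Qed.

Definition pone : presented := wclass [::].
Definition pinv (g : presented) : presented := wclass (winv (wrepr g)).
Definition pmul (g h : presented) : presented := wclass (wrepr g ++ wrepr h).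

Fact pmulE u v : pmul (wclass u) (wclass v) = wclass (u ++ v).
Proof. by apply/wclassP; apply: pres_eq_cat; apply/wclassP/wreprK. Qed.

Fact pinvE u : pinv (wclass u) = wclass (winv u).
Proof. by apply/wclassP; apply: pres_eq_inv; apply/wclassP/wreprK. Qed.

Fact pmulA : associative pmul.
Proof.
by move=> x y z; rewrite -[x]wreprK -[y]wreprK -[z]wreprK !pmulE catA.
Qed.

Fact pmul1 : left_id pone pmul.
Proof. by move=> x; rewrite -[x]wreprK pmulE. Qed.

Fact pmulr1 : right_id pone pmul.
Proof. by move=> x; rewrite -[x]wreprK pmulE cats0. Qed.

Fact pmulV : left_inverse pone pinv pmul.
Proof.
by move=> x; rewrite -[x]wreprK pinvE pmulE; apply/wclassP/pres_eq_Vcat.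
Qed.

Fact pmulrV : right_inverse pone pinv pmul.
Proof.
by move=> x; rewrite -[x]wreprK pinvE pmulE; apply/wclassP/pres_eq_catV.
Qed.

HB.instance Definition _ :=
  isGroup.Build presented pmulA pmul1 pmulr1 pmulV pmulrV.

Lemma wclass1 : wclass [::] = 1%g.
Proof. by []. Qed.

Lemma wclassM u v : wclass (u ++ v) = (wclass u * wclass v)%g.
Proof. by rewrite -pmulE. Qed.

Lemma wclassV u : wclass (winv u) = (wclass u)^-1%g.
Proof. by rewrite -pinvE. Qed.

Lemma wclass_surj (g : presented) : exists w, g = wclass w.
Proof. by exists (wrepr g); rewrite wreprK. Qed.

End Presentations.

Section Reidemeister.
Local Open Scope classical_set_scope.
Variable G : groupType.

Definition twisted_class (phi : {multiplicative G -> G}) (x : G) : set G :=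
  [set y | exists g : G, y = (g * x * (phi g)^-1)%g].

Definition twisted_classes (phi : {multiplicative G -> G}) : set (set G) :=
  range (twisted_class phi).

Definition reidemeister_number (phi : {multiplicative G -> G}) : \bar nat :=
  if `[< finite_set (twisted_classes phi) >]
  then (#|` fset_set (twisted_classes phi) |)%fset%:E%E
  else +oo%E.

Definition R_infinity : Prop :=
  forall phi : {multiplicative G -> G},
    bijective phi -> reidemeister_number phi = +oo%E.

End Reidemeister.

Section Pi4.
Local Open Scope ring_scope.

Inductive Pi4_gen := Pi4_a of 'I_2 | Pi4_alpha | Pi4_beta.

Definition Pi4_gen_encode (x : Pi4_gen) : 'I_2 + bool :=
  match x with
  | Pi4_a i => inl i
  | Pi4_alpha => inr true
  | Pi4_beta => inr false
  end.

Definition Pi4_gen_decode (x : 'I_2 + bool) : Pi4_gen :=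
  match x with
  | inl i => Pi4_a i
  | inr true => Pi4_alpha
  | inr false => Pi4_beta
  end.

Fact Pi4_gen_encodeK : cancel Pi4_gen_encode Pi4_gen_decode.
Proof. by case. Qed.

HB.instance Definition _ := Choice.copy Pi4_gen (can_type Pi4_gen_encodeK).

(* The generators a_1, a_2 are [a 0], [a 1]. *)
Local Notation a i := (gen (Pi4_a i)).
Local Notation alpha := (gen Pi4_alpha).
Local Notation beta := (gen Pi4_beta).

Definition Pi4_apow (x : 'cV[int]_2) : word Pi4_gen :=
  wexp (a 0) (x 0 0) ++ wexp (a 1) (x 1 0).

Inductive Pi4_rel (N : 'M[int]_2) (k : 'cV[int]_2) :
  word Pi4_gen -> word Pi4_gen -> Prop :=
| Pi4_rel_comm :
    Pi4_rel N k (a 0 ++ a 1 ++ winv (a 0) ++ winv (a 1)) [::]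
| Pi4_rel_alpha_a i : Pi4_rel N k (alpha ++ a i ++ winv alpha) (winv (a i))
| Pi4_rel_alpha2 : Pi4_rel N k (alpha ++ alpha) [::]
| Pi4_rel_beta_a i :
    Pi4_rel N k (beta ++ a i ++ winv beta) (Pi4_apow (col i N))
| Pi4_rel_alpha_beta :
    Pi4_rel N k (alpha ++ beta ++ winv alpha) (Pi4_apow k ++ beta).

Definition Pi4 (N : 'M[int]_2) (k : 'cV[int]_2) : groupType :=
  presented (Pi4_rel N k).

(* For tr A >= 2, sqrtC is the usual nonnegative real square root. *)
Definition neg_sqrt_mx (A : 'M[int]_2) : 'M[algC]_2 :=
  - (sqrtC (\tr A - 2)%:~R)^-1 *: map_mx intr (A - 1%:M).

(* Since (A - I)^2 = (tr A - 2) A when det A = 1, [neg_sqrt_mx A] is a square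
   root of A; the content of this predicate is that it has integer entries. *)
Definition is_integer_neg_sqrt (A N : 'M[int]_2) : Prop :=
  map_mx intr N = neg_sqrt_mx A.

End Pi4.

(* Main.v *)
Require Import Defs.
From mathcomp Require Import all_boot all_order all_algebra.
From mathcomp Require Import algC boolp classical_sets cardinality.
From mathcomp Require Import constructive_ereal.
From mathcomp Require Import zify ring.

Set Implicit Arguments.
Unset Strict Implicit.
Unset Printing Implicit Defensive.

Import Order.TTheory GRing.Theory Num.Theory.
Local Open Scope ring_scope.

(** Write a^x for the translation attached to x in Z^2. The matrix N has
    determinant -1 and nonzero trace, since N = -(A - 1)/s with
    s^2 = tr A - 2 = - det (A - 1).

    Structure of the group. The defining relations allow every element to be
    rewritten as a^x alpha^e beta^n ([normal_form]). Here n is the exponent sum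
    of beta ([bexp]), and x |-> a^x is injective because the group acts on Z^2
    by affine maps in which a^x is the translation by 2x ([A_inj]); the factor
    2 makes room for the cocycle k of beta without dividing by 2. Every
    homomorphism to Z is a multiple of bexp ([additive_bexp]), and the
    translations are exactly the elements g of exponent 0 such that g^2 = 1
    forces g = 1 ([translationP]).

    Let phi be an automorphism. Both descriptions are invariant, so phi
    multiplies bexp by a sign and restricts on the translations to some M in
    GL_2(Z).

    If phi preserves bexp, twisted conjugation preserves bexp as well, and the
    powers of beta lie in pairwise distinct classes ([preserving_infinite]).

    If phi reverses bexp, applying phi to the relation beta a^x = a^(Nx) beta
    gives N M N = M or N M N = - M ([reversing_mx]). With
    N^2 = (tr N) N + 1 and tr N <> 0, either equation forces
    tr M = tr (N M) = 0. One of M, N M has determinant -1, hence eigenvalues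
    1 and -1, so det (1 - Y M) = 0 for Y = 1 or Y = N
    ([det_1sub_twisted]). Take y = 1 or y = beta accordingly, an element that
    acts on translations by Y. An element that twists one element a^v y into
    another has exponent 0, because bexp changes by twice its exponent. So it
    is a^w, which moves v by (1 - Y M) w, or a^w alpha, which also reflects v.
    A nonzero linear form vanishing on the image of 1 - Y M takes infinitely
    many values on Z^2, and each twisted class meets at most two of them
    ([fibre_infinite]). *)

(** * Twisted conjugacy classes *)

Section GroupMorphism.
Local Open Scope group_scope.
Variables (G H : groupType) (f : G -> H).
Hypothesis fM : {morph f : x y / x * y}.

Lemma morphg1 : f 1 = 1.
Proof. by apply: (mulgI (f 1)); rewrite -fM !mulg1. Qed.

End GroupMorphism.

Lemma reidemeister_number_infinite (G : groupType)
    (phi : {multiplicative G -> G}) (x : nat -> G) :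
  (forall m n g, x m = (g * x n * (phi g)^-1)%g -> m = n) ->
  reidemeister_number phi = +oo%E.
Proof.
move=> x_sep; rewrite /reidemeister_number ifF //; apply/asboolP => fin.
pose f n := twisted_class phi (x n).
apply: infinite_nat.
have -> : [set: nat]%classic = (f @^-1` twisted_classes phi)%classic.
  by rewrite eqEsubset; split=> // n _; exists (x n).
apply: finite_preimage => // m n _ _ fmn.
have [g] : f n (x m).
  by rewrite -fmn; exists 1%g;
    rewrite (morphg1 (@gmulfM _ _ phi)) invg1 mul1g mulg1.
exact: x_sep.
Qed.

(** * Two by two matrices *)

Lemma ord2E (i : 'I_2) : (i = 0) + (i = 1).
Proof. by case: i => -[|[|//]] ?; [left|right]; apply/val_inj. Qed.

Lemma sum_ord2 (R : nmodType) (F : 'I_2 -> R) : \sum_i F i = F 0 + F 1.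
Proof.
by rewrite !big_ord_recl big_ord0 addr0; congr (_ + F _); apply/val_inj.
Qed.

Lemma det_mx22 (R : comRingType) (A : 'M[R]_2) :
  \det A = A 0 0 * A 1 1 - A 0 1 * A 1 0.
Proof.
rewrite (expand_det_row _ 0) sum_ord2 /cofactor !det_mx11 !mxE /=.
have -> : lift 0 0 = 1 :> 'I_2 by apply/val_inj.
have -> : lift 1 0 = 0 :> 'I_2 by apply/val_inj.
by rewrite /= expr0 expr1 mul1r mulN1r mulrN.
Qed.

Lemma det_1subr_mx22 (R : comRingType) (A : 'M[R]_2) :
  \det (1%:M - A) = 1 - \tr A + \det A.
Proof. by rewrite !det_mx22 /mxtrace sum_ord2 !mxE /=; ring. Qed.

Lemma Cayley_Hamilton_mx22 (R : comRingType) (A : 'M[R]_2) :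
  A *m A = \tr A *: A - (\det A)%:M.
Proof.
apply/matrixP => i j; rewrite det_mx22 /mxtrace !mxE !sum_ord2.
by case: (ord2E i) => ->; case: (ord2E j) => -> /=;
  rewrite ?mulr1n ?mulr0n; ring.
Qed.

(** Taking traces of N M N = e M and of N (N M N) = e (N M), after replacing
    N^2 by (tr N) N + 1, gives two linear equations in tr M and tr (N M) whose
    only solution is 0. A traceless 2 x 2 matrix X has det (1 - X) = 1 + det X,
    and of det M and det (N M) = - det M one equals -1. *)
Lemma det_1sub_twisted (N M : 'M[int]_2) (e : int) :
  \det N = -1 -> \tr N != 0 -> M \in unitmx -> (e = 1 \/ e = -1) ->
  N *m M *m N = e *: M ->
  exists2 Y, Y = 1%:M \/ Y = N & \det (1%:M - Y *m M) = 0.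
Proof.
move=> detN trN0 uM e1 NMN.
have NN : N *m N = \tr N *: N + 1%:M.
  by rewrite Cayley_Hamilton_mx22 detN raddfN opprK.
have trNM : \tr N * \tr (N *m M) + \tr M = e * \tr M.
  by rewrite -(mxtraceZ e) -NMN (mxtrace_mulC (N *m M)) mulmxA NN mulmxDl mul1mx
    -scalemxAl raddfD /= mxtraceZ.
have trMN : e * \tr (N *m M) = e * (\tr N * \tr M) + \tr (N *m M).
  rewrite -(mxtraceZ e) scalemxAr -NMN -(mulmxA N M) (mulmxA N N) NN.
  rewrite mulmxDl mul1mx raddfD /= -scalemxAl mulmxA NMN !mxtraceZ.
  by rewrite (mxtrace_mulC M) mulrCA.
have [trM0 trNM0] : \tr M = 0 /\ \tr (N *m M) = 0.
  case: e1 trNM trMN => ->.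
    rewrite !mul1r => tT tm; split; apply: (mulfI trN0); rewrite mulr0.
      by move: tm; lia.
    by move: tT; lia.
  rewrite !mulN1r => tT tm.
  have trM0 : \tr M = 0.
    (* eliminating tr (N M) leaves (tr N ^ 2 + 4) tr M = 0 *)
    apply: (@mulfI _ (\tr N ^+ 2 + 4)).
      by rewrite gt_eqF // ltr_wpDl // sqr_ge0.
    rewrite mulr0 mulrDl expr2 -mulrA.
    have -> : \tr N * \tr M = 2 * \tr (N *m M) by move: tm; lia.
    by rewrite mulrCA; move: tT; lia.
  by split=> //; move: tm; rewrite trM0 mulr0; lia.
have detM : \det M = 1 \/ \det M = -1.
  by move: uM; rewrite unitmxE => /orP[]/eqP; [left|right].
case: detM => detM.
  by exists N; [right|rewrite det_1subr_mx22 trNM0 det_mulmx detN detM].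
by exists 1%:M; [left|rewrite mul1mx det_1subr_mx22 trM0 detM].
Qed.

(** N is - (A - 1) / s with s^2 = tr A - 2, and det A = 1 gives
    det (A - 1) = 2 - tr A; thus det N = - s^2 / s^2 and tr N = - s. *)
Lemma integer_neg_sqrt_char (A N : 'M[int]_2) :
  \det A = 1 -> 2 < \tr A -> is_integer_neg_sqrt A N ->
  \det N = -1 /\ \tr N != 0.
Proof.
move=> detA trA AN.
have s2 : sqrtC (\tr A - 2)%:~R ^+ 2 = (\tr A - 2)%:~R :> algC.
  by rewrite sqrtCK.
have t0 : (\tr A - 2)%:~R != 0 :> algC by rewrite intr_eq0 subr_eq0 gt_eqF.
move: AN; rewrite /is_integer_neg_sqrt /neg_sqrt_mx.
move: s2; set s := sqrtC _ => s2 AN.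
have s0 : s != 0 by apply: contraNneq t0 => s0; rewrite -s2 s0 expr0n.
split.
- apply/eqP; rewrite -(eqr_int algC) -det_map_mx AN detZ det_map_mx.
  have -> : \det (A - 1%:M) = - (\tr A - 2).
    by rewrite -opprB -scaleN1r detZ det_1subr_mx22 detA; ring.
  by rewrite sqrrN exprVn s2 !rmorphN /= mulrN mulVf.
- rewrite -(intr_eq0 algC) -trace_map_mx AN mxtraceZ trace_map_mx.
  by rewrite raddfB /= mxtrace1 mulf_neq0 // oppr_eq0 invr_eq0.
Qed.

(** * Integer powers and maps out of Z^n *)

Section IntegerPower.
Local Open Scope group_scope.
Variables (G : groupType) (x : G).

Definition zexpg (n : int) : G :=
  match n with
  | Posz m => x ^+ m
  | Negz m => x ^- m.+1
  end.

Lemma zexpg_succ n : zexpg (1 + n)%R = x * zexpg n.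
Proof.
case: n => [n|[|n]]; [by rewrite /= expgS|by rewrite /= mulgV|].
have -> : (1 + Negz n.+1)%R = Negz n by lia.
by rewrite /= [x ^+ n.+2]expgSr invgM mulVKg.
Qed.

Lemma zexpg_pred n : zexpg (- 1 + n)%R = x^-1 * zexpg n.
Proof. by rewrite -{2}(addNKr 1%R n) zexpg_succ mulKg. Qed.

Lemma zexpgD m n : zexpg (m + n)%R = zexpg m * zexpg n.
Proof.
elim/int_ind: m => [|m IHm|m IHm]; first by rewrite add0r mul1g.
  by rewrite intS -addrA !zexpg_succ IHm mulgA.
by rewrite intS opprD -addrA !zexpg_pred IHm mulgA.
Qed.

End IntegerPower.

Section FreeAbelianSource.
Local Open Scope group_scope.
Variables (H : groupType) (n : nat).
Implicit Types f g : 'cV[int]_n -> H.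

Lemma addmul_morph0 f : {morph f : x y / (x + y)%R >-> x * y} -> f 0%R = 1.
Proof. by move=> fD; apply: (mulgI (f 0%R)); rewrite -fD addr0 mulg1. Qed.

(** Z^n is generated by its standard basis. The target is not assumed
    commutative, which is why the sum becomes an ordered product. *)
Lemma addmul_morph_ext f g :
  {morph f : x y / (x + y)%R >-> x * y} ->
  {morph g : x y / (x + y)%R >-> x * y} ->
  (forall i, f (delta_mx i 0%R) = g (delta_mx i 0%R)) -> f =1 g.
Proof.
move=> fD gD fg x.
have fgz y (z : int) : f y = g y -> f (y *~ z)%R = g (y *~ z)%R.
  have hN (h : _ -> H) : {morph h : x y / (x + y)%R >-> x * y} ->
      h (- y)%R = (h y)^-1.
    by move=> hD; apply/esym/mulg1_eq; rewrite -hD subrr addmul_morph0.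
  move=> fgy; elim/int_ind: z => [|m IHm|m IHm].
  - by rewrite !addmul_morph0.
  - by rewrite intS mulrzDr mulr1z fD gD fgy IHm.
  - by rewrite intS opprD mulrzDr mulrNz mulr1z fD gD !hN // fgy IHm.
have -> : x = (\sum_i delta_mx i 0 *~ x i 0)%R.
  apply/colP => i; rewrite summxE (bigD1 i) //= big1 ?addr0 => [|j /negPf ji].
    by rewrite -scaler_int !mxE !eqxx mulr1 intz.
  by rewrite -scaler_int !mxE eq_sym ji mulr0.
rewrite (big_morph f fD (addmul_morph0 fD)) (big_morph g gD (addmul_morph0 gD)).
by apply: eq_bigr => i _; apply: fgz.
Qed.

End FreeAbelianSource.

(** * Groups given by a presentation *)

Section PresentedGroup.
Local Open Scope group_scope.
Variables (X : choiceType) (rel : word X -> word X -> Prop).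
Local Notation cl := (wclass rel).

Lemma wclass_false x : cl [:: (x, false)] = (cl (gen x))^-1.
Proof. by rewrite -wclassV. Qed.

Lemma wclass_wexp w n : cl (wexp w n) = zexpg (cl w) n.
Proof.
have clX u m : cl (flatten (nseq m u)) = cl u ^+ m.
  by elim: m => // m IHm; rewrite expgS /= wclassM IHm.
by case: n => m; rewrite [LHS]clX // wclassV expVgn.
Qed.

Lemma presented_ind (P : presented rel -> Prop) :
  P 1 -> (forall x g, P g -> P (cl (gen x) * g) /\ P ((cl (gen x))^-1 * g)) ->
  forall g, P g.
Proof.
move=> P1 PM g; have [w ->] := wclass_surj g.
elim: w => [|[x b] w IHw] //; rewrite -cat1s wclassM.
have [Pt Pf] := PM x _ IHw.
by case: b => //; rewrite wclass_false.
Qed.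

Variables (T : Type) (act : X * bool -> T -> T).

(** An action given on letters extends to words from the right, so that
    concatenation becomes composition. If the letters x and x^-1 act by
    mutually inverse maps and the defining relations hold, it descends to the
    presented group; this is how elements are told apart below. *)
Definition wact (w : word X) (t : T) : T := foldr act t w.

Lemma wact_cat u v t : wact (u ++ v) t = wact u (wact v t).
Proof. exact: foldr_cat. Qed.

Definition gact (g : presented rel) : T -> T := wact (wrepr g).

Hypothesis actK : forall x b t, act (x, b) (act (x, ~~ b) t) = t.
Hypothesis act_rel : forall u v, rel u v -> wact u =1 wact v.

Lemma pres_eq_wact u v : pres_eq rel u v -> wact u =1 wact v.
Proof.
elim=> {u v} [u v /act_rel||||u v w _ uv _ vw t|u u' v v' _ uu _ vv t] //.
- by move=> u v _ uv t; rewrite uv.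
- by rewrite uv vw.
- by rewrite !wact_cat vv uu.
Qed.

Lemma gact_wclass w : gact (cl w) =1 wact w.
Proof. by apply: pres_eq_wact; apply/wclassP/wreprK. Qed.

End PresentedGroup.

Lemma wact_wexp_translation (X : choiceType) (T : zmodType)
    (act : X * bool -> T -> T) (x : X) (c t : T) (n : int) :
  (forall t, act (x, true) t = c + t) ->
  (forall t, act (x, false) t = - c + t) ->
  wact act (wexp (gen x) n) t = c *~ n + t.
Proof.
move=> actT actF.
have actX (b : bool) d m : (forall t, act (x, b) t = d + t) ->
    wact act (flatten (nseq m [:: (x, b)])) t = d *+ m + t.
  move=> actb; elim: m => [|m IHm] /=; first by rewrite mulr0n add0r.
  by rewrite actb IHm mulrS addrA.
case: n => m; first exact: (actX true).
by rewrite [LHS](actX false (- c)) // NegzE mulrNz mulNrn.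
Qed.

(** * Structure of the group *)

Section Pi4Structure.
Variables (N : 'M[int]_2) (k : 'cV[int]_2).
Hypothesis detN : \det N = -1.

Local Notation G := (presented (Pi4_rel N k)).
Local Notation cl := (wclass (Pi4_rel N k)).
Local Notation a i := (cl (gen (Pi4_a i))).
Local Notation alpha := (cl (gen Pi4_alpha)).
Local Notation beta := (cl (gen Pi4_beta)).
Local Notation A x := (cl (Pi4_apow x)).
Local Notation Ninv := (N - (\tr N)%:M).

Lemma mulNinv : N *m Ninv = 1%:M.
Proof.
rewrite mulmxBr Cayley_Hamilton_mx22 detN mul_mx_scalar raddfN.
by rewrite addrC opprK addKr.
Qed.

Lemma mulmxNinv : Ninv *m N = 1%:M.
Proof. exact: mulmx1C mulNinv. Qed.

(** The relation alpha beta alpha^-1 = a^k beta holds for alpha = (v |-> - v)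
    and beta = (v |-> N v + u) only if a^k translates by - 2 u. Letting a^x
    translate by 2 x rather than x gives the integral solution u = - k. *)
Definition affine_letter (l : Pi4_gen * bool) (v : 'cV[int]_2) : 'cV[int]_2 :=
  match l with
  | (Pi4_a i, b) => (-1) ^+ (~~ b) *: (delta_mx i 0 *+ 2) + v
  | (Pi4_alpha, _) => - v
  | (Pi4_beta, true) => N *m v - k
  | (Pi4_beta, false) => Ninv *m (v + k)
  end.

Definition beta_letter (l : Pi4_gen * bool) (n : int) : int :=
  match l with
  | (Pi4_beta, b) => (-1) ^+ (~~ b) + n
  | _ => n
  end.

Lemma affine_apow x v : wact affine_letter (Pi4_apow x) v = x *+ 2 + v.
Proof.
have aT i n t : wact affine_letter (wexp (gen (Pi4_a i)) n) t
              = (delta_mx i 0 *+ 2) *~ n + t.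
  by apply: wact_wexp_translation => u; rewrite /= ?scale1r ?scaleN1r.
rewrite wact_cat !aT addrA; congr (_ + v); apply/colP => i.
rewrite -!scaler_int !mxE !intz.
by case: (ord2E i) => -> /=; lia.
Qed.

Lemma beta_apow x n : wact beta_letter (Pi4_apow x) n = n.
Proof.
have aT i m t : wact beta_letter (wexp (gen (Pi4_a i)) m) t = t.
  by rewrite (@wact_wexp_translation _ _ _ _ 0) ?mul0rz => // [|u|u];
     rewrite /= ?add0r ?oppr0 ?add0r.
by rewrite wact_cat !aT.
Qed.

Lemma affine_letterK x b v :
  affine_letter (x, b) (affine_letter (x, ~~ b) v) = v.
Proof.
case: x b => [i||] [] /=; rewrite ?expr0 ?expr1 ?scale1r ?scaleN1r ?opprK.
- by rewrite addNKr.
- by rewrite addKr.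
- by [].
- by [].
- by rewrite mulmxA mulNinv mul1mx addrK.
- by rewrite subrK mulmxA mulmxNinv mul1mx.
Qed.

Lemma affine_rel u v :
  Pi4_rel N k u v -> wact affine_letter u =1 wact affine_letter v.
Proof.
case=> {u v} [|i||i|] t.
- rewrite /= ?expr0 ?expr1 ?scale1r ?scaleN1r.
  by rewrite (addrCA (delta_mx 1 0 *+ 2)) !addNKr.
- by rewrite /= expr0 expr1 scale1r scaleN1r opprD opprK.
- by rewrite /= opprK.
- rewrite affine_apow /= expr0 scale1r mulmxDr mulmxA mulNinv mul1mx.
  by rewrite addrA addrK !mulr2n mulmxDr -colE.
- rewrite [RHS]wact_cat affine_apow /= mulmxN opprD !opprK.
  by rewrite mulr2n addrAC addrCA subrr addr0 addrC.
Qed.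

Lemma beta_letterK x b n :
  beta_letter (x, b) (beta_letter (x, ~~ b) n) = n.
Proof. by case: x b => [i||] [] //=; lia. Qed.

Lemma beta_rel u v :
  Pi4_rel N k u v -> wact beta_letter u =1 wact beta_letter v.
Proof.
case=> {u v} [|i||i|] t //; first by rewrite beta_apow /= expr0 expr1; lia.
by rewrite [RHS]wact_cat beta_apow.
Qed.

Definition bexp (g : G) : int := gact beta_letter g 0.

Lemma bexp_wclass w : bexp (cl w) = wact beta_letter w 0.
Proof. exact: gact_wclass beta_letterK beta_rel w 0. Qed.

Lemma bexpM g h : bexp (g * h)%g = bexp g + bexp h.
Proof.
have [[u ->] [v ->]] := (wclass_surj g, wclass_surj h).
rewrite -wclassM !bexp_wclass wact_cat; move: (wact _ v 0) => n.
elim: u => [|[[i||] b] u IHu] //=; first by rewrite add0r.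
by rewrite IHu addrA.
Qed.

Lemma bexp1 : bexp 1%g = 0.
Proof. by rewrite -wclass1 bexp_wclass. Qed.

Lemma bexpV g : bexp g^-1%g = - bexp g.
Proof. by apply/eqP; rewrite -addr_eq0 -bexpM mulVg bexp1. Qed.

Lemma bexp_a x : bexp (A x) = 0.
Proof. by rewrite bexp_wclass beta_apow. Qed.

Lemma bexp_alpha : bexp alpha = 0.
Proof. by rewrite bexp_wclass. Qed.

Lemma bexp_beta : bexp beta = 1.
Proof. by rewrite bexp_wclass. Qed.

Lemma A_inj x y : A x = A y -> x = y.
Proof.
move=> /(congr1 (fun g => gact affine_letter g 0)).
rewrite !(gact_wclass affine_letterK affine_rel) !affine_apow !addr0.
move=> /colP xy; apply/colP => i; move: (xy i).
have twice (p q : int) : p + p = q + q -> p = q by lia.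
by rewrite !mulr2n !mxE; apply: twice.
Qed.

Local Open Scope group_scope.

Lemma cl_rel u v : Pi4_rel N k u v -> cl u = cl v.
Proof. by move=> uv; apply/wclassP/pres_eq_rel. Qed.

Lemma A_D x y : A (x + y)%R = A x * A y.
Proof.
have comm01 : commute (a 0%R) (a 1%R).
  have := cl_rel (Pi4_rel_comm N k).
  by rewrite !wclassM !wclassV wclass1 mulgA -invgM => /divg1_eq.
rewrite /Pi4_apow !wclassM !wclass_wexp !mxE !zexpgD.
have cz m n : commute (zexpg (a 0%R) m) (zexpg (a 1%R) n).
  have cX p q : commute (a 0%R ^+ p) (a 1%R ^+ q) by apply: commuteX2.
  case: m n => m [] n; rewrite /zexpg //; first exact: commuteV.
    by apply/commute_sym/commuteV/commute_sym.
  by apply: commuteV; apply/commute_sym/commuteV/commute_sym.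
by rewrite !mulgA; congr (_ * _); rewrite -!mulgA (cz (y 0 0)%R).
Qed.

Lemma A_0 : A 0%R = 1.
Proof. exact: addmul_morph0 A_D. Qed.

Lemma A_N x : A (- x)%R = (A x)^-1.
Proof. by apply/esym/mulg1_eq; rewrite -A_D subrr A_0. Qed.

Lemma A_delta i : A (delta_mx i 0%R) = a i.
Proof.
by rewrite /Pi4_apow wclassM !wclass_wexp !mxE;
  case: (ord2E i) => -> /=; rewrite ?mulg1 ?mul1g.
Qed.

(** Serves both for conjugations and for restrictions of automorphisms. *)
Lemma A_morph (f : G -> G) (L : 'M[int]_2) :
  {morph f : x y / x * y} ->
  (forall i, f (a i) = A (L *m delta_mx i 0%R)%R) ->
  forall x, f (A x) = A (L *m x)%R.
Proof.
move=> fM fa; apply: (@addmul_morph_ext _ _ (fun x => f (A x))) => [x y|x y|i].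
- by rewrite A_D fM.
- by rewrite mulmxDr A_D.
- by rewrite A_delta fa.
Qed.

Lemma conjA g (L : 'M[int]_2) :
  (forall i, g * a i * g^-1 = A (L *m delta_mx i 0%R)%R) ->
  forall x, g * A x = A (L *m x)%R * g.
Proof.
move=> ga x; rewrite -[LHS](mulgVK g); congr (_ * g).
move: x; apply: (@A_morph (fun h => g * h * g^-1)) => // x y.
by rewrite -!mulgA mulKg.
Qed.

Lemma alpha_A x : alpha * A x = A (- x)%R * alpha.
Proof.
have N1 y : (- y)%R = (- 1%:M *m y)%R :> 'cV[int]_2 by rewrite mulNmx mul1mx.
rewrite N1; apply: conjA => i; rewrite -N1 A_N A_delta.
have := cl_rel (Pi4_rel_alpha_a N k i).
by rewrite !wclassM !wclassV mulgA.
Qed.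

Lemma beta_A x : beta * A x = A (N *m x)%R * beta.
Proof.
apply: conjA => i; have := cl_rel (Pi4_rel_beta_a N k i).
by rewrite !wclassM !wclassV mulgA colE.
Qed.

Lemma betaV_A x : beta^-1 * A x = A (Ninv *m x)%R * beta^-1.
Proof.
apply: (mulgI beta); rewrite mulVKg mulgA beta_A mulmxA mulNinv mul1mx.
by rewrite mulgK.
Qed.

Lemma alpha2 : alpha * alpha = 1.
Proof. by have := cl_rel (Pi4_rel_alpha2 N k); rewrite wclassM wclass1. Qed.

Lemma alphaV : alpha^-1 = alpha.
Proof. exact/mulg1_eq/alpha2. Qed.

Lemma alpha_beta : alpha * beta = A k * beta * alpha.
Proof.
have := cl_rel (Pi4_rel_alpha_beta N k).
by rewrite !wclassM !wclassV mulgA => <-; rewrite mulgVK.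
Qed.

Lemma beta_alpha : beta * alpha = A (- k)%R * alpha * beta.
Proof. by rewrite -mulgA alpha_beta A_N -!mulgA mulKg. Qed.

Lemma betaV_alpha : beta^-1 * alpha = A (Ninv *m k)%R * alpha * beta^-1.
Proof.
apply: (mulIg beta); rewrite mulgVK -mulgA alpha_beta.
by rewrite -!mulgA (mulgA beta^-1) betaV_A -!mulgA mulKg.
Qed.

(** Left multiplication by any letter or its inverse preserves this shape:
    alpha and beta move past translations, and beta past alpha at the cost of
    a translation. *)
Lemma normal_form g :
  exists x (e : bool), g = A x * alpha ^+ e * zexpg beta (bexp g).
Proof.
move: g; apply: presented_ind => [|l g [x [e Eg]]].
  by exists 0%R, false; rewrite bexp1 A_0 !mulg1.
have aM y : exists x' (e' : bool),
    A y * g = A x' * alpha ^+ e' * zexpg beta (bexp (A y * g)).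
  exists (y + x)%R, e; rewrite bexpM bexp_a add0r A_D {1}Eg.
  by rewrite -!mulgA.
have alphaM : exists x' (e' : bool),
    alpha * g = A x' * alpha ^+ e' * zexpg beta (bexp (alpha * g)).
  exists (- x)%R, (~~ e); rewrite bexpM bexp_alpha add0r {1}Eg.
  rewrite !mulgA alpha_A -(mulgA _ alpha); congr (_ * _ * _).
  by case: (e); rewrite /= ?mulg1 ?expg1 ?alpha2.
case: l => [i||].
- by split; [|rewrite -A_delta -A_N]; rewrite -?A_delta; apply: aM.
- by rewrite alphaV.
- split.
    rewrite bexpM bexp_beta zexpg_succ {1}Eg !mulgA beta_A.
    case: e Eg => Eg; rewrite /= ?expg1 ?expg0 ?mulg1.
      exists (N *m x - k)%R, true.
      by rewrite A_D -(mulgA _ beta) beta_alpha expg1 !mulgA.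
    by exists (N *m x)%R, false; rewrite mulg1 mulgA.
  rewrite bexpM bexpV bexp_beta zexpg_pred {1}Eg !mulgA betaV_A.
  case: e Eg => Eg; rewrite /= ?expg1 ?expg0 ?mulg1.
    exists (Ninv *m x + Ninv *m k)%R, true.
    by rewrite A_D -(mulgA _ beta^-1) betaV_alpha expg1 !mulgA.
  by exists (Ninv *m x)%R, false; rewrite mulg1 mulgA.
Qed.

Lemma bexp0_form g : bexp g = 0%R -> exists x (e : bool), g = A x * alpha ^+ e.
Proof.
move=> g0; have [x [e Eg]] := normal_form g; exists x, e.
by rewrite Eg g0 mulg1.
Qed.

(** A description of the translations inside bexp^-1(0) that refers only to
    the group law: the other elements a^x alpha of bexp^-1(0) are involutions,
    whereas translations have no torsion. *)
Lemma translationP g :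
  (exists x, g = A x) <-> bexp g = 0%R /\ (g * g = 1 -> g = 1).
Proof.
split=> [[x ->]|[/bexp0_form[x [[] ->]] gg]].
- split=> [|]; first exact: bexp_a.
  rewrite -A_D -A_0 => /A_inj /colP xx; congr (A _); apply/colP => i.
  have twice (p : int) : (p + p = 0 -> p = 0)%R by lia.
  by move: (xx i); rewrite !mxE; apply: twice.
- exists 0%R; rewrite A_0 gg // expg1 mulgA -(mulgA (A x)) alpha_A.
  by rewrite A_N mulgA mulgV mul1g alpha2.
- by exists x; rewrite mulg1.
Qed.

(** Otherwise alpha, having order at most 2, would be trivial, yet it inverts
    translations. *)
Lemma alpha_not_translation x : alpha <> A x.
Proof.
move=> Ealpha; have [_ /(_ alpha2) alpha1] : bexp alpha = 0%R /\
    (alpha * alpha = 1 -> alpha = 1) by apply/translationP; exists x.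
have := alpha_A (delta_mx 0 0)%R; rewrite alpha1 mulg1 mul1g.
by move=> /A_inj /colP /(_ 0%R); rewrite !mxE.
Qed.

(** The abelianization is finite modulo beta: alpha is an involution, and it
    inverts each a_i, so alpha and the a_i have trivial image in Z. *)
Lemma additive_bexp (f : G -> int) :
  {morph f : x y / x * y >-> (x + y)%R} ->
  forall g, f g = (f beta * bexp g)%R.
Proof.
move=> fM.
have f1 : f 1 = 0%R by apply: (addrI (f 1)); rewrite -fM mulg1 addr0.
have fV g : f g^-1 = (- f g)%R.
  by apply/eqP; rewrite -addr_eq0 -fM mulVg f1.
have twice (p : int) : (p + p = 0 -> p = 0)%R by lia.
have falpha : f alpha = 0%R by apply: twice; rewrite -fM alpha2.
have fa i : f (a i) = 0%R.
  apply: twice; have := congr1 f (alpha_A (delta_mx i 0)%R).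
  by rewrite !fM A_N fV A_delta falpha add0r addr0 => {1}->; rewrite addNr.
apply: presented_ind => [|l g IHg]; first by rewrite f1 bexp1 mulr0.
rewrite !fM !bexpM fV bexpV IHg.
case: l => [i||].
- by rewrite fa -A_delta bexp_a oppr0 !add0r.
- by rewrite falpha bexp_alpha oppr0 !add0r.
- by rewrite bexp_beta !mulrDr mulr1 mulrN1.
Qed.

(** * Automorphisms *)

Section Automorphism.
Variable phi : {multiplicative G -> G}.
Hypothesis phi_bij : bijective phi.

Let phiM : {morph phi : x y / x * y} := @gmulfM _ _ phi.
Let phi1 : phi 1 = 1 := morphg1 phiM.
Let phi_inj : injective phi := bij_inj phi_bij.

Let phi_surj g : exists h, phi h = g.
Proof. by case: phi_bij => psi _ psiK; exists (psi g). Qed.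

Lemma bexp_phi g : bexp (phi g) = (bexp (phi beta) * bexp g)%R.
Proof.
by apply: (@additive_bexp (bexp \o phi)) => x y /=; rewrite phiM bexpM.
Qed.

Lemma bexp_phi_beta : bexp (phi beta) = 1%R \/ bexp (phi beta) = (-1)%R.
Proof.
have [h Eh] := phi_surj beta.
have : bexp (phi beta) \is a GRing.unit.
  by apply/unitrPr; exists (bexp h); rewrite -bexp_phi Eh bexp_beta.
by case/orP=> /eqP; [left|right].
Qed.

Lemma phi_translationP g : (exists x, phi g = A x) <-> (exists x, g = A x).
Proof.
have phi_eq1 h : phi h = 1 <-> h = 1.
  by split=> [|->//]; rewrite -{1}phi1 => /phi_inj.
rewrite !translationP -phiM !phi_eq1 bexp_phi.
by split=> -[b0 gg]; split=> //; case: bexp_phi_beta b0 => ->; lia.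
Qed.

(** Invertibility of M comes from surjectivity of phi: by [phi_translationP]
    the preimage of each a_i is again a translation, and the preimages form
    the columns of an inverse of M. *)
Lemma phi_mx :
  exists2 M : 'M[int]_2, M \in unitmx & forall x, phi (A x) = A (M *m x)%R.
Proof.
have phiA x : exists y, phi (A x) = A y by apply/phi_translationP; exists x.
have /choice[m Em] i : exists y, phi (a i) = A y.
  by rewrite -A_delta.
pose M := (\matrix_(i, j) m j i 0)%R.
have EM x : phi (A x) = A (M *m x)%R.
  apply: A_morph => // i; rewrite Em -colE; congr (A _).
  by apply/colP => j; rewrite !mxE.
exists M => //.
have /choice[n En] i : exists x, A (M *m x)%R = a i.
  have [h Eh] := phi_surj (a i).
  have [x Ex] : exists x, h = A x.
    by apply/phi_translationP; exists (delta_mx i 0)%R; rewrite A_delta.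
  by exists x; rewrite -EM -Ex.
suff /mulmx1_unit[] : (M *m (\matrix_(i, j) n j i 0) = 1%:M)%R by [].
apply/matrixP => i j.
have /A_inj/colP/(_ i) : A (M *m n j)%R = A (delta_mx j 0)%R.
  by rewrite En A_delta.
rewrite !mxE eqxx andbT => <-.
by apply: eq_bigr => l _; rewrite mxE.
Qed.

Lemma phi_alpha : exists p, phi alpha = A p * alpha.
Proof.
have [|p [[] Ep]] := @bexp0_form (phi alpha).
- by rewrite bexp_phi bexp_alpha mulr0.
- by exists p.
have [x] : exists x, alpha = A x.
  by apply/phi_translationP; exists p; rewrite Ep mulg1.
by move=> /alpha_not_translation.
Qed.

Lemma alphaX_A (e : bool) x :
  alpha ^+ e * A x = A ((-1) ^+ e *: x)%R * alpha ^+ e.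
Proof.
case: e; first by rewrite expg1 expr1 scaleN1r alpha_A.
by rewrite expr0 scale1r mulg1 mul1g.
Qed.

(** Since phi beta = a^q alpha^e beta^-1, it acts on translations by
    (-1)^e N^-1, while phi transports the action of beta to that of
    phi beta: M N = (-1)^e N^-1 M. *)
Lemma reversing_mx (M : 'M[int]_2) :
  (forall x, phi (A x) = A (M *m x)%R) -> bexp (phi beta) = (-1)%R ->
  exists e : bool, (N *m M *m N = (-1) ^+ e *: M)%R.
Proof.
move=> phiA phib.
have [|q [e]] := @bexp0_form (phi beta * beta).
  by rewrite bexpM phib bexp_beta.
move=> /(canRL (mulgK beta)) Eb; exists e.
suff E : (M *m N = (-1) ^+ e *: (Ninv *m M))%R.
  by rewrite -mulmxA E -scalemxAr mulmxA mulNinv mul1mx.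
apply/matrixP => i j; pose d : 'cV[int]_2 := delta_mx j 0%R.
have /A_inj : A (M *m (N *m d) + q)%R
            = A (q + (-1) ^+ e *: (Ninv *m (M *m d)))%R.
  apply: (mulIg (alpha ^+ e * beta^-1)); rewrite !A_D -!mulgA.
  rewrite (mulgA (A q) _ beta^-1) -Eb -phiA -phiM -beta_A phiM phiA Eb.
  by rewrite -!mulgA betaV_A (mulgA _ (A (Ninv *m _)%R)) alphaX_A -!mulgA.
rewrite addrC => /addrI; rewrite !mulmxA scalemxAl -!colE.
by move=> /colP /(_ i); rewrite !mxE.
Qed.

(** Let l be a nonzero row killed by 1 - Y M and lam v = l v. If g = a^w alpha^e
    twists a^v y into a^v' y, then lam v' = lam v when e = 0, and
    lam v' = - lam v + lam c when e = 1. *)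
Lemma fibre_infinite (M Y : 'M[int]_2) (y : G) (c : 'cV[int]_2) :
  bexp (phi beta) = (-1)%R ->
  (forall x, phi (A x) = A (M *m x)%R) ->
  (forall x, y * A x = A (Y *m x)%R * y) ->
  alpha * y * (phi alpha)^-1 = A c * y ->
  (\det (1%:M - Y *m M) = 0)%R ->
  reidemeister_number phi = +oo%E.
Proof.
move=> phib phiA yA alpha_y /eqP/det0P[l l0 lYM].
have [j lj0] : exists j, (l 0 j != 0)%R.
  by apply/existsP; apply: contraNT l0; rewrite negb_exists => /forallP l0;
     apply/eqP/rowP => j; rewrite mxE; apply/eqP; move: (l0 j); rewrite negbK.
pose lam (v : 'cV[int]_2) : int := ((l *m v) 0 0)%R.
have lamD u v : (lam (u + v) = lam u + lam v)%R by rewrite /lam mulmxDr mxE.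
have lamN v : (lam (- v) = - lam v)%R by rewrite /lam mulmxN mxE.
have lamYM w : lam (Y *m (M *m w))%R = lam w.
  apply/eqP; rewrite eq_sym -subr_eq0 -lamN -lamD /lam mulmxA.
  by rewrite -{1}[w]mul1mx -mulmxBl mulmxA lYM mul0mx mxE.
(* the offset |lam c| + 1 keeps lam (v m) + lam (v n) away from lam c *)
pose f n : int := (n%:Z + `|lam c| + 1)%R.
pose v n : 'cV[int]_2 := (f n *: delta_mx j 0)%R.
have lamv n : lam (v n) = (f n * l 0 j)%R.
  by rewrite /lam /v -scalemxAr -colE !mxE.
have bphi g : bexp (phi g) = (- bexp g)%R by rewrite bexp_phi phib mulN1r.
apply: (@reidemeister_number_infinite _ _ (fun n => A (v n) * y)) => m n g Emn.
have g0 : bexp g = 0%R.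
  by move: (congr1 bexp Emn); rewrite !bexpM bexpV bphi !bexp_a; lia.
have yAV w : y * (A w)^-1 = A (- (Y *m w))%R * y by rewrite -A_N yA mulmxN.
have [w [e Eg]] := bexp0_form g0; case: e Eg => Eg.
  have Ev : v m = (w - v n + c - Y *m (M *m w))%R.
    apply: A_inj; apply: (mulIg y); rewrite Emn Eg expg1 phiM phiA invgM.
    rewrite !A_D -(mulgA _ _ y) -yAV -!mulgA (mulgA alpha) alpha_A.
    by rewrite -!mulgA (mulgA alpha y) (mulgA (alpha * y)) alpha_y -!mulgA.
  have : ((f m + f n) * l 0 j = lam c)%R.
    rewrite mulrDl; move: (congr1 lam Ev).
    rewrite !lamD !lamN lamYM !lamv; move: (_ * _)%R (_ * _)%R (lam _) (lam _).
    by lia.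
  have : (f m + f n > `|lam c|)%R by rewrite /f; lia.
  move: (f m + f n)%R (lam c) (l 0%R j) lj0 => F C L L0 FC FL.
  have : (`|F| * `|L| = `|C|)%R by rewrite -normrM FL.
  by nia.
have Ev : v m = (w + v n - Y *m (M *m w))%R.
  apply: A_inj; apply: (mulIg y); rewrite Emn Eg mulg1 phiA.
  by rewrite !A_D -(mulgA _ _ y) -yAV !mulgA.
have /(mulIf lj0) : (f m * l 0 j = f n * l 0 j)%R.
  by move: (congr1 lam Ev); rewrite !lamD !lamN lamYM !lamv => ->; lia.
by rewrite /f; lia.
Qed.

Lemma reversing_infinite : (\tr N != 0)%R -> bexp (phi beta) = (-1)%R ->
  reidemeister_number phi = +oo%E.
Proof.
move=> trN phib; have [M uM phiA] := phi_mx; have [p Ep] := phi_alpha.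
have [e NMN] := reversing_mx phiA phib.
have sgn_e : ((-1) ^+ e = 1 :> int \/ (-1) ^+ e = -1 :> int)%R.
  by case: e {NMN}; [right|left].
have [Y [] -> detYM] := det_1sub_twisted detN trN uM sgn_e NMN.
  apply: (fibre_infinite (y := 1) (c := - p) phib phiA _ _ detYM) => [x|].
    by rewrite mul1mx mul1g mulg1.
  by rewrite Ep invgM !mulg1 mulVKg A_N.
apply: (fibre_infinite (c := k - N *m p) phib phiA beta_A _ detYM).
rewrite Ep invgM alpha_beta mulgA mulgK -A_N -mulgA beta_A mulgA.
by rewrite A_D mulmxN.
Qed.

Lemma preserving_infinite : bexp (phi beta) = 1%R ->
  reidemeister_number phi = +oo%E.
Proof.
move=> phib.
have bphi g : bexp (phi g) = bexp g by rewrite bexp_phi phib mul1r.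
have bX n : bexp (beta ^+ n) = n.
  elim: n => [|n IHn]; first exact: bexp1.
  by rewrite expgS bexpM IHn bexp_beta intS.
apply: (@reidemeister_number_infinite _ _ (fun n => beta ^+ n)) => m n g.
by move=> /(congr1 bexp); rewrite !bexpM bexpV bphi !bX; lia.
Qed.

End Automorphism.

End Pi4Structure.

(** * The R_infinity property *)

Unset Implicit Arguments.

Theorem theorem6p2 (A N : 'M[int]_2) (k : 'cV[int]_2)
  (detA : \det A = 1) (trA : 2 < \tr A) (AN : is_integer_neg_sqrt A N) :
  R_infinity (Pi4 N k).
Proof.
have [detN trN] := integer_neg_sqrt_char detA trA AN.
move=> phi phi_bij.
by have [] := bexp_phi_beta detN phi_bij;
  [exact: preserving_infinite|exact: reversing_infinite].
Qed.
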